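(* Let $k\ge 2$ and $n_1,\dots,n_k\ge 1$ be integers, $n=\sum_{i=1}^k n_i$, and let $F$ be an arbitrary continuous distribution function on $\mathbb{R}$. Let $\mathbf{X}=(X_{1,1},\ldots,X_{1,n_1},X_{2,1},\ldots,X_{2,n_2},\ldots,X_{k,1},\ldots,X_{k,n_k})$ be $k$ samples of mutually independent random variables such that $X_{i,j}$ ($i=1,\ldots,k$, $j=1,\ldots,n_i$) has distribution function $$F_{i,k}(x)=\sum_{t=i}^k\binom{k}{t}[F(x)]^t[1-F(x)]^{k-t}.$$ Let $\mathbf{R}=(R_{1,1},\ldots,R_{1,n_1},\ldots,R_{k,1},\ldots,R_{k,n_k})$ be the rank order vector of $\mathbf{X}$, and let $\mathbf{r}=(r_{1,1},\ldots,r_{1,n_1},\ldots,r_{k,1},\ldots,r_{k,n_k})$ be a given permutation of $\{1,2,\ldots,n\}$. Then $$P(\mathbf{R}=\mathbf{r})=P\left(X_{a_1(\mathbf{r}),b_1(\mathbf{r})}\le X_{a_2(\mathbf{r}),b_2(\mathbf{r})}\le\cdots\le X_{a_n(\mathbf{r}),b_n(\mathbf{r})}\right)$$ $$=\int\cdots\int_{0\le y_{a_1(\mathbf{r}),b_1(\mathbf{r})}\le y_{a_2(\mathbf{r}),b_2(\mathbf{r})}\le\cdots\le y_{a_n(\mathbf{r}),b_n(\mathbf{r})}\le 1}\ \prod_{i=1}^k\prod_{j=1}^{n_i} d\left(\sum_{t=i}^k\binom{k}{t}y_{i,j}^t(1-y_{i,j})^{k-t}\right).$$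
   Context: The rank $R_{i,j}$ of $X_{i,j}$ is the integer such that exactly $R_{i,j}-1$ of the other coordinates $X_{g,h}$, $(g,h)\ne(i,j)$, of $\mathbf{X}$ are less than $X_{i,j}$. Since the distributions are continuous, with probability 1 there are no ties and $\mathbf{R}$ is a permutation of $\{1,\ldots,n\}$. For a permutation $\mathbf{r}=(r_{i,h})$ of $\{1,\dots,n\}$ indexed by pairs $(i,h)$, $1\le i\le k$, $1\le h\le n_i$, and for $j=1,\ldots,n$: $a_j(\mathbf{r})$ is the sample index of the coordinate with rank $j$, i.e. $a_j(\mathbf{r})=\sum_{i=1}^k\sum_{h=1}^{n_i} i\,\mathbf{1}\{r_{i,h}=j\}$, and $b_j(\mathbf{r})$ is its index within its sample, i.e. $b_j(\mathbf{r})=\sum_{h=1}^{n_{a_j(\mathbf{r})}} h\,\mathbf{1}\{r_{a_j(\mathbf{r}),h}=j\}$. Equivalently, $(a_j(\mathbf{r}),b_j(\mathbf{r}))$ is the unique pair $(i,h)$ with $r_{i,h}=j$. The integral is over the $n$ real variables $y_{i,j}$, and $d(G(y_{i,j}))$, for a polynomial $G$, denotes integration with respect to $G'(y_{i,j})\,dy_{i,j}$. *)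

(* Defs.v *)
From HB Require Import structures.
From mathcomp Require Import all_boot all_order all_algebra all_fingroup.
From mathcomp Require Import all_classical all_reals all_analysis.

Set Implicit Arguments.
Unset Strict Implicit.
Unset Printing Implicit Defensive.

Import Order.TTheory GRing.Theory Num.Theory.
Import numFieldNormedType.Exports.

Local Open Scope classical_set_scope.
Local Open Scope ring_scope.

Definition mutually_independent d (T : measurableType d) (R : realType)
    (P : probability T R) (I : finType) (X : I -> {RV P >-> R}) : Prop :=
  forall (J : {set I}) (B : I -> set R),
    (forall i, i \in J -> measurable (B i)) ->
    P (\bigcap_(i in [set` J]) X i @^-1` B i) =
    (\prod_(i in J) P (X i @^-1` B i))%E.

(* F_{i,k} and the polynomial G with F_{i,k} = G o F. Here i is 1-based; as
   samples are indexed by i : 'I_k below, these are used at i.+1. *)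
Definition upper_binomial_df (R : realType) (k i : nat) (F : R -> R) (x : R)
    : R :=
  \sum_(i <= t < k.+1) 'C(k, t)%:R * F x ^+ t * (1 - F x) ^+ (k - t).

Definition upper_binomial_poly (R : realType) (k i : nat) : {poly R} :=
  \sum_(i <= t < k.+1) 'C(k, t)%:R *: ('X^t * (1 - 'X) ^+ (k - t)).

Section sample_indices.
Context (k : nat) (n_ : 'I_k -> nat).
Local Notation n := (\sum_i n_ i)%N.
Implicit Types (r : 'S_n) (l : 'I_n).

(* Pairs (i, h) are numbered lexicographically by tagnat.Rank. A permutation
   (r_{i,h}) of {1, ..., n} is encoded by r : 'S_n, both sides being shifted to
   start from 0: the 1-based rank is r_{i,h} = (rank_at r i h).+1. *)
Definition rank_at r (i : 'I_k) (h : 'I_(n_ i)) : 'I_n := r (tagnat.Rank i h).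

Definition rank_vector (R : realType) (x : forall i, 'I_(n_ i) -> R)
    (i : 'I_k) (h : 'I_(n_ i)) : nat :=
  #|[set q : {i : 'I_k & 'I_(n_ i)} |
      (q != Tagged (fun i => 'I_(n_ i)) h) &&
      (x (tag q) (tagged q) < x i h)]|.+1.

(* a_j and b_j (both shifted by 1) for j = l.+1: the unique pair of rank j. See
   sample_atE and within_atE for the formulas as sums. *)
Definition sample_at r l : 'I_k := tagnat.sig1 (r^-1%g l).

Definition within_at r l : 'I_(n_ (sample_at r l)) := tagnat.sig2 (r^-1%g l).

(* The sequence x_{a_1,b_1}, ..., x_{a_n,b_n}. *)
Definition arranged r (S : Type) (x : forall i, 'I_(n_ i) -> S) : seq S :=
  [seq x (sample_at r l) (within_at r l) | l <- enum 'I_n].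

Definition entry (S : Type) (y : n.-tuple S) (i : 'I_k) (h : 'I_(n_ i)) : S :=
  tnth y (tagnat.Rank i h).

Lemma rank_at_within r l : rank_at r (within_at r l) = l.
Proof. by rewrite /rank_at /within_at tagnat.sig2K permKV. Qed.

Lemma rank_at_eq r l (i : 'I_k) (h : 'I_(n_ i)) :
  (rank_at r h == l) = (Tagged (fun i => 'I_(n_ i)) h ==
                        Tagged (fun i => 'I_(n_ i)) (within_at r l)).
Proof.
have -> : Tagged (fun i => 'I_(n_ i)) (within_at r l) = tagnat.sig (r^-1%g l).
  by rewrite tagnat.sigE12.
rewrite -(inj_eq (@tagnat.rank_inj _ _)) tagnat.sigK /rank_at.
by rewrite -[in RHS](inj_eq (@perm_inj _ r)) permKV.
Qed.

Lemma sample_atE r l :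
  (sample_at r l).+1 =
  (\sum_i \sum_(h < n_ i) i.+1 * (rank_at r h == l))%N.
Proof.
rewrite (@sig_big_dep _ _ _ _ (fun i => 'I_(n_ i)) xpredT (fun=> xpredT)
  (fun i h => i.+1 * (rank_at r h == l)))%N/=.
rewrite (bigD1 (Tagged (fun i => 'I_(n_ i)) (within_at r l)))//=.
rewrite rank_at_within eqxx muln1 big1 ?addn0// => -[i h]/= /negPf ih.
by rewrite rank_at_eq ih muln0.
Qed.

Lemma within_atE r l :
  (within_at r l).+1 =
  (\sum_(h < n_ (sample_at r l)) h.+1 * (rank_at r h == l))%N.
Proof.
rewrite (bigD1 (within_at r l))//= rank_at_within eqxx muln1 big1 ?addn0//.
by move=> h /negPf nh; rewrite rank_at_eq eq_Tagged/= nh muln0.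
Qed.

End sample_indices.
Arguments rank_at {k n_} r i h.
Arguments rank_vector {k n_ R} x i h.
Arguments entry {k n_ S} y i h.

Section lebesgue_tuple.
Context (R : realType).
Local Notation T := (measurableTypeR R).
Local Notation mu := (@lebesgue_measure R).

Section step.
Context (n : nat) (m : {sigma_finite_measure set (n.-tuple T) -> \bar R}).

Definition tuple_of_pair (x : T * n.-tuple T) : n.+1.-tuple T :=
  [tuple of x.1 :: x.2].

Let measurable_tuple_of_pair : measurable_fun setT tuple_of_pair.
Proof. by apply: measurable_cons. Qed.

HB.instance Definition _ :=
  isMeasurableFun.Build _ _ _ _ tuple_of_pair measurable_tuple_of_pair.

Definition lebesgue_cons : set (n.+1.-tuple T) -> \bar R :=
  pushforward (mu \x m)%E tuple_of_pair.

Let lebesgue_cons0 : lebesgue_cons set0 = 0%E.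
Proof. exact: measure0. Qed.

Let lebesgue_cons_ge0 A : (0 <= lebesgue_cons A)%E.
Proof. exact: measure_ge0. Qed.

Let lebesgue_cons_sigma_additive : semi_sigma_additive lebesgue_cons.
Proof. exact: measure_semi_sigma_additive. Qed.

HB.instance Definition _ := isMeasure.Build _ _ _ lebesgue_cons
  lebesgue_cons0 lebesgue_cons_ge0 lebesgue_cons_sigma_additive.

Let lebesgue_cons_sigma_finite : sigma_finite setT lebesgue_cons.
Proof.
have /sigma_finiteP[F [TF ndF Foo]] :=
  sigma_finiteT (mu : {sigma_finite_measure set T -> \bar R}).
have /sigma_finiteP[G [TG ndG Goo]] := sigma_finiteT m.
pose head (y : n.+1.-tuple T) : T := tnth y ord0.
pose tail (y : n.+1.-tuple T) : n.-tuple T := [tuple of behead y].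
exists (fun i => head @^-1` F i `&` tail @^-1` G i).
  apply/esym; rewrite -subTset => y _.
  have [i _ Fi] : (\bigcup_i F i) (head y) by rewrite -TF.
  have [j _ Gj] : (\bigcup_i G i) (tail y) by rewrite -TG.
  exists (maxn i j) => //; split.
    by have /subsetPset := ndF _ _ (leq_maxl i j); exact.
  by have /subsetPset := ndG _ _ (leq_maxr i j); exact.
move=> i; have [mF Fi] := Foo i; have [mG Gi] := Goo i; split.
  apply: measurableI; rewrite -[X in measurable X]setTI.
    exact: (@measurable_tnth _ T n.+1 ord0).
  exact: measurable_behead.
rewrite /lebesgue_cons /pushforward.
rewrite [X in (mu \x m)%E X](_ : _ = F i `*` G i).
  by rewrite product_measure1E// lte_mul_pinfty// ge0_fin_numE.
have tailK x y : tail (tuple_of_pair (x, y)) = y by exact: val_inj.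
by apply/seteqP; split=> -[x y]; rewrite /setI/= tailK.
Qed.

HB.instance Definition _ := Measure_isSigmaFinite.Build _ _ _ lebesgue_cons
  lebesgue_cons_sigma_finite.

End step.

(* n-fold product of Lebesgue measure, see lebesgue_tuple_box *)
Fixpoint lebesgue_tuple (n : nat) :
    {sigma_finite_measure set (n.-tuple T) -> \bar R} :=
  if n is n'.+1 then lebesgue_cons (lebesgue_tuple n')
  else \d_ ([tuple] : 0.-tuple T).

Lemma lebesgue_tuple_box n (B : 'I_n -> set T) :
  (forall i, measurable (B i)) ->
  lebesgue_tuple n [set y | forall i, B i (tnth y i)] =
  (\prod_(i < n) mu (B i))%E.
Proof.
elim: n B => [|n IH] B mB; first by rewrite big_ord0/= diracE mem_set//; case.
rewrite big_ord_recl -IH//= -product_measure1E//.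
  rewrite /lebesgue_cons /pushforward; congr (_ _).
  apply/seteqP; split=> -[x y]/=.
    move=> BE; split; first exact: (BE ord0).
    by move=> i; have := BE (lift ord0 i); rewrite tnthS.
  by move=> [B0 BS] i; have [j ->|->//] := unliftP ord0 i; rewrite tnthS.
rewrite [X in measurable X](_ : _ =
    \bigcap_(i in [set: 'I_n]) (@tnth n T ^~ i @^-1` B (lift ord0 i))).
  apply: fin_bigcap_measurable => // i _; rewrite -[X in measurable X]setTI.
  exact: measurable_tnth.
by apply/seteqP; split=> y By i; [move=> _|]; exact: (By i).
Qed.

End lebesgue_tuple.

(* Main.v *)
Require Import Defs.
From HB Require Import structures.
From mathcomp Require Import all_boot all_order all_algebra all_fingroup.
From mathcomp Require Import all_classical all_reals all_analysis.
From mathcomp Require Import measurable_realfun.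

Import Order.TTheory GRing.Theory Num.Theory.
Import numFieldNormedType.Exports.

Local Open Scope classical_set_scope.
Local Open Scope ring_scope.

(* The variables U = F(X) satisfy P(U_(i,j) <= u) = G_i(u) on [0, 1], where G_i
   is the polynomial with F_(i,k) = G_i o F, so U_(i,j) has density G_i' on
   [0, 1], and by independence the vector of the U_(i,j) has the product
   density. Two coordinates of U are almost surely distinct, since the diagonals
   are Lebesgue-null. Off the ties of U, monotonicity of F makes the three
   events "R = r", "X is sorted along r" and "U is sorted along r" coincide, and
   the probability of the last one is the integral. *)

(** * The polynomials [G_i]: derivative, sign and endpoint values *)

(* The derivative of the t-th summand is a_t - a_(t+1), where
   a_t = t 'C(k, t) y^(t-1) (1-y)^(k-t). *)
Lemma deriv_upper_binomial_poly (R : realType) (k i : nat) : (i <= k)%N ->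
  (upper_binomial_poly R k i)^`() =
  (i * 'C(k, i))%:R *: ('X^(i.-1) * (1 - 'X) ^+ (k - i)).
Proof.
move=> ik.
pose a t : {poly R} := (t * 'C(k, t))%:R *: ('X^(t.-1) * (1 - 'X) ^+ (k - t)).
have ak : a k.+1 = 0 by rewrite /a bin_small// muln0 scale0r.
rewrite /upper_binomial_poly raddf_sum/=.
(* The sum telescopes to [a_i - a_(k+1)], and [a_(k+1) = 0] because ['C(k, k+1) = 0]; the sign
   matches the orientation of [telescope_sumr]. *)
transitivity (- \sum_(i <= t < k.+1) (a t.+1 - a t)); last first.
  by rewrite telescope_sumr ?leqW// ak sub0r opprK.
rewrite -sumrN; apply: eq_big_nat => t /andP[_ tk].
rewrite opprB derivZ derivM derivXn deriv_exp derivB derivC derivX sub0r.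
(* The identity [(t+1) 'C(k, t+1) = (k-t) 'C(k, t)] turns [a_(t+1)] into the second term of the
   product rule. *)
rewrite /a mul_bin_left subnS/=.
rewrite mulNr mul1r mulNrn mulrN mulrnAl mulrnAr scalerBr.
by congr (_ - _); rewrite -[X in _ *: X]scaler_nat scalerA -natrM mulnC.
Qed.

(** By the closed form, for [i >= 1] this is the Beta density with parameters [i] and [k-i+1], that
    is, the density of the [i]-th order statistic of [k] uniform variables. *)
Lemma deriv_upper_binomial_poly_ge0 (R : realType) (k i : nat) (x : R) :
  (i <= k)%N -> 0 <= x <= 1 -> 0 <= ((upper_binomial_poly R k i)^`()).[x].
Proof.
move=> ik /andP[x0 x1]; rewrite deriv_upper_binomial_poly//.
rewrite hornerZ hornerM hornerXn horner_exp !hornerE.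
by rewrite !mulr_ge0 ?exprn_ge0// subr_ge0.
Qed.

Lemma horner_upper_binomial_poly (R : realType) (k i : nat) (F : R -> R) x :
  (upper_binomial_poly R k i).[F x] = upper_binomial_df k i F x.
Proof.
rewrite /upper_binomial_poly horner_sum; apply: eq_bigr => t _.
by rewrite !hornerE/= -mulrA.
Qed.

Lemma upper_binomial_poly0 (R : realType) (k i : nat) : (0 < i)%N ->
  (upper_binomial_poly R k i).[0] = 0.
Proof.
move=> i0; rewrite /upper_binomial_poly horner_sum.
rewrite big_nat big1// => t /andP[it _].
rewrite hornerZ hornerM hornerXn expr0n gtn_eqF ?(leq_trans i0)//.
by rewrite mul0r mulr0.
Qed.

Lemma upper_binomial_poly1 (R : realType) (k i : nat) : (i <= k)%N ->
  (upper_binomial_poly R k i).[1] = 1.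
Proof.
move=> ik; rewrite /upper_binomial_poly horner_sum big_nat_recr//= big_nat big1.
  by rewrite add0r !hornerE/= binn subnn expr0 expr1n !mulr1.
move=> t /andP[_ tk]; rewrite hornerZ hornerM horner_exp !hornerE subrr expr0n.
by rewrite subn_eq0 leqNgt tk/= !mulr0.
Qed.

(** * Measures on the line and integration over the [n]-fold Lebesgue measure *)

(** Open right rays are stable under intersection and generate the Borel sets, and the rays from
    [-k] exhaust the line; finiteness passes from the line to these rays. *)
Lemma eq_finite_measure_ray (R : realType)
    (m1 m2 : {measure set (measurableTypeR R) -> \bar R}) :
  (forall x, m1 `]x, +oo[%classic = m2 `]x, +oo[%classic) ->
  (m1 setT < +oo)%E ->
  forall A, measurable A -> m1 A = m2 A.
Proof.
move=> m12 m1oo; move=> A mA.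
apply: (@measure_unique _ R (measurableTypeR R)
  (@RGenOInfty.G R) (fun k => `]- k%:R, +oo[%classic)) => //.
- exact: RGenOInfty.measurableE.
- move=> _ _ [x ->] [y ->]; exists (Num.max x y).
  apply/seteqP; split=> z /=; rewrite !in_itv/= !andbT gt_max.
    by move=> [-> ->].
  by move=> /andP.
- by move=> k; exists (- k%:R).
- apply/seteqP; split=> // x _; exists (Num.bound x) => //=.
  by rewrite /= in_itv/= andbT ltrNl unstable.ltrNbound.
- by move=> _ [x ->].
- by move=> k; apply: le_lt_trans m1oo; apply: le_measure; rewrite ?inE.
Qed.
Lemma measurable_tuple_of_pair (R : realType) n :
  measurable_fun setT (@tuple_of_pair R n).
Proof. by apply: measurable_cons. Qed.

Section integral_lebesgue_tupleS.
Context (R : realType) (n : nat).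
Context (f : n.+1.-tuple (measurableTypeR R) -> \bar R).
Hypotheses (mf : measurable_fun setT f) (f0 : (forall y, 0 <= f y)%E).

Let mfp : measurable_fun setT (f \o @tuple_of_pair R n).
Proof. exact: measurableT_comp mf (@measurable_tuple_of_pair R n). Qed.

(** [lebesgue_tuple R n.+1] is by construction the image of the product measure under
    [tuple_of_pair], so this is a change of variables. *)
Let integral_pairE : (\int[lebesgue_tuple R n.+1]_y f y =
  \int[@lebesgue_measure R \x lebesgue_tuple R n]_z
    (f \o @tuple_of_pair R n) z)%E.
Proof. by rewrite [LHS]ge0_integral_pushforward. Qed.

Lemma integral_lebesgue_tupleS1 : (\int[lebesgue_tuple R n.+1]_y f y =
  \int[@lebesgue_measure R]_x \int[lebesgue_tuple R n]_y
    f (tuple_of_pair (x, y)))%E.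
Proof. by rewrite integral_pairE fubini_tonelli1// => z; exact: f0. Qed.

(** Tonelli in the other order, with the head integrated first; it serves the diagonals that involve
    the head. *)
Lemma integral_lebesgue_tupleS2 : (\int[lebesgue_tuple R n.+1]_y f y =
  \int[lebesgue_tuple R n]_y \int[@lebesgue_measure R]_x
    f (tuple_of_pair (x, y)))%E.
Proof. by rewrite integral_pairE fubini_tonelli2// => z; exact: f0. Qed.

End integral_lebesgue_tupleS.

Lemma measurable_prod_tnth (R : realType) n (f : 'I_n -> R -> R) :
  (forall i, measurable_fun setT (f i)) ->
  measurable_fun setT
    (fun y : n.-tuple (measurableTypeR R) => \prod_i f i (tnth y i)).
Proof.
move=> mf; apply: (@measurable_prod _ _ _ _ _ _
  (fun i (y : n.-tuple (measurableTypeR R)) => f i (tnth y i))) => i _.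
apply: (measurableT_comp (mf i)).
exact: (@measurable_tnth _ (measurableTypeR R) n i).
Qed.

(** Induction on [n]: Tonelli splits off the head, and each of the two factors is constant for the
    integral over the other variable. The base case is the mass 1 of the Dirac measure. *)
Lemma integral_lebesgue_tuple_prod (R : realType) n (f : 'I_n -> R -> R) :
  (forall i, measurable_fun setT (f i)) -> (forall i x, 0 <= f i x) ->
  (\int[lebesgue_tuple R n]_y (\prod_i f i (tnth y i))%:E =
   \prod_i \int[@lebesgue_measure R]_x (f i x)%:E)%E.
Proof.
elim: n f => [|n IH] f mf f0.
  under eq_integral do rewrite big_ord0.
  by rewrite big_ord0 integral_cst//= diracT mule1.
rewrite integral_lebesgue_tupleS1; last 2 first.
- by apply/measurable_EFinP; exact: measurable_prod_tnth.
- by move=> y; rewrite lee_fin prodr_ge0.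
rewrite big_ord_recl -(IH (fun i => f (lift ord0 i)))//.
rewrite -ge0_integralZr//; last 3 first.
- by apply/measurable_EFinP; exact: mf.
- by move=> x _; rewrite lee_fin.
- by apply: integral_ge0 => y _; rewrite lee_fin prodr_ge0.
apply: eq_integral => x _; rewrite -ge0_integralZl//.
- apply: eq_integral => y _; rewrite big_ord_recl/= (_ : tnth _ ord0 = x)//.
  by under eq_bigr do rewrite tnthS.
- apply/measurable_EFinP.
  exact: (@measurable_prod_tnth _ _ (fun i => f (lift ord0 i))).
- by move=> y _; rewrite lee_fin prodr_ge0.
- by rewrite lee_fin.
Qed.

(** * Diagonals *)

Lemma measurable_eq_fun d (T : measurableType d) (R : realType) (f g : T -> R) :
  measurable_fun setT f -> measurable_fun setT g ->
  measurable [set w | f w = g w].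
Proof.
move=> mf mg; rewrite [X in measurable X](_ : _ = (f \- g) @^-1` [set 0]).
  by rewrite -[X in measurable X]setTI; exact: (measurable_funB mf mg).
by apply/seteqP; split=> w /=; [move=> ->; rewrite subrr|move/subr0_eq].
Qed.

Lemma measurable_diagonal (R : realType) n (i j : 'I_n) :
  measurable [set y : n.-tuple (measurableTypeR R) | tnth y i = tnth y j].
Proof.
have mt s := @measurable_tnth _ (measurableTypeR R) n s.
exact: (measurable_eq_fun _ _ R _ _ (mt i) (mt j)).
Qed.

(** Induction on [n], computing the measure as an iterated integral of the indicator. Slices at a
    fixed head are lower-dimensional diagonals, and slices at a fixed tail are single points. *)
Lemma lebesgue_tuple_diagonal (R : realType) n (i j : 'I_n) : i != j ->
  lebesgue_tuple R n [set y | tnth y i = tnth y j] = 0%E.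
Proof.
elim: n i j => [[]//|n IH] i j.
(* With [i < j], the index [j] lies in the tail and only [i] can be the head. *)
wlog ij : i j / (i < j)%N => [H ij|_].
  have [ij'|ji|/val_inj ij'] := ltngtP i j; [exact: H| |].
    rewrite -(H j i) 1?eq_sym//; congr (_ _).
    by apply/seteqP; split=> y /=; exact: esym.
  by rewrite ij' eqxx in ij.
have [j' jE|jE] := unliftP ord0 j; last by rewrite jE in ij.
set D := [set _ | _]; have mDij : measurable D by exact: measurable_diagonal.
have mD1 : measurable_fun setT (fun y => (\1_D y)%:E : \bar R).
  by apply/measurable_EFinP; exact: measurable_indic.
rewrite -[D in LHS]setIT -integral_indic//.
have [i' iE|iE] := unliftP ord0 i.
  rewrite integral_lebesgue_tupleS1// integral0_eq// => x _.
  rewrite -[RHS](IH i' j'); last first.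
    by apply: contraTneq ij => ij'; rewrite iE jE ij' ltnn.
  rewrite -[X in _ = _ X]setIT -integral_indic//; last first.
    exact: measurable_diagonal.
  apply: eq_integral => y _; rewrite !indicE; congr ((nat_of_bool _)%:R)%:E.
  by apply/idP/idP => /set_mem H; apply/mem_set; move: H;
    rewrite /D/= iE jE !tnthS.
(* Here [i] is the head: for a fixed tail [y], the slice is the point [tnth y j']. *)
rewrite integral_lebesgue_tupleS2// integral0_eq// => y _.
rewrite -[RHS](lebesgue_measure_set1 (tnth y j')).
rewrite -[X in _ = _ X]setIT -integral_indic//.
apply: eq_integral => x _; rewrite !indicE; congr ((nat_of_bool _)%:R)%:E.
by apply/idP/idP => /set_mem H; apply/mem_set; move: H;
  rewrite /D/= iE jE tnthS.
Qed.

(** * Densities and the joint law of independent variables *)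

(** Stated as an existence so that a measure structure depending on hypotheses about [f] can be
    obtained in the middle of a proof. *)
Lemma ex_density_measure d (T : measurableType d) (R : realType)
    (mu : {measure set T -> \bar R}) (f : T -> \bar R) :
  measurable_fun setT f -> (forall x, 0 <= f x)%E ->
  exists m : {measure set T -> \bar R},
    forall A, m A = (\int[mu]_(x in A) f x)%E.
Proof.
move=> mf f0; pose m A := (\int[mu]_(x in A) f x)%E.
have m0 : m set0 = 0%E by rewrite /m integral_set0.
have m_ge0 A : (0 <= m A)%E by apply: integral_ge0.
have msA : semi_sigma_additive m by exact: semi_sigma_additive_nng_induced.
pose mM := isMeasure.Build _ _ _ m m0 m_ge0 msA.
pose m' : {measure set T -> \bar R} := HB.pack m mM.
by exists m'.
Qed.

Lemma ex_pushforward_measure d d' (T : measurableType d)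
    (T' : measurableType d') (R : realType) (mu : {measure set T -> \bar R})
    (f : T -> T') :
  measurable_fun setT f ->
  exists m : {measure set T' -> \bar R}, forall A, m A = mu (f @^-1` A).
Proof.
move=> mf; pose m' : {measure set T' -> \bar R} := pushforward mu f.
by exists (m' mf).
Qed.

(** The fundamental theorem of calculus on the part of the ray inside [[0, 1]]; clamping [u] to
    [[0, 1]] gives the left end of that part. *)
Lemma integral_deriv_ray (R : realType) (G : {poly R}) (u : R) :
  (\int[@lebesgue_measure R]_(x in `]u, +oo[)
     ((G^`()).[x] * \1_`[0, 1] x)%:E =
   (G.[1] - G.[Num.min 1 (Num.max 0 u)])%:E)%E.
Proof.
transitivity (\int[@lebesgue_measure R]_(x in `]u, +oo[)
    ((fun x => (G^`()).[x]%:E) \_ `[0%R, 1%R]) x)%E.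
  apply: eq_integral => x _; rewrite patchE indicE.
  by case: ifPn => _; rewrite ?mulr1 ?mulr0.
rewrite -integral_mkcondr.
have [u1|u1] := leP 1 u.
  rewrite min_l ?subrr; last by rewrite le_max u1 orbT.
  rewrite (_ : _ `&` _ = set0) ?integral_set0//.
  apply/seteqP; split=> x //=; rewrite !in_itv/= andbT => -[ux /andP[_ x1]].
  by move: ux; rewrite ltNge (le_trans x1).
set v := Num.max 0 u.
have v1 : v < 1 by rewrite gt_max ltr01.
have v0 : 0 <= v by rewrite le_max lexx.
rewrite min_r ?(ltW v1)//.
(* For [u < 0] the ray covers [[0, 1]] and [v = 0]; otherwise the domain is []u, 1]], which differs
   from [[v, 1]] by a null point. *)
transitivity (\int[@lebesgue_measure R]_(x in `[v, 1%R]) ((G^`()).[x])%:E)%E.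
  have [u0|u0] := ltP u 0.
    rewrite /v max_l ?ltW//; congr (integral _ _ _); apply/seteqP; split=> x /=.
      by case.
    by rewrite !in_itv/= => /andP[x0 ->]; rewrite x0 (lt_le_trans u0).
  rewrite /v max_r// -[RHS](integral_itv_obnd_cbnd); last first.
    by apply: measurable_funTS; apply/measurable_EFinP;
      exact: continuous_measurable_fun (@continuous_horner _ _).
  congr (integral _ _ _); apply/seteqP; split=> x /=; rewrite !in_itv/= andbT.
    by move=> [-> /andP[_ ->]].
  by move=> /andP[ux ->]; rewrite ux (le_trans u0)// ltW.
rewrite (@continuous_FTC2 _ _ (horner G))//.
- by apply: continuous_subspaceT => x; exact: continuous_horner.
- split=> [x _| |]; first exact: derivable_horner.
    by apply: cvg_at_right_filter; exact: continuous_horner.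
  by apply: cvg_at_left_filter; exact: continuous_horner.
- by move=> x _; rewrite derivE.
Qed.

(** Boxes are stable under intersection and generate the product sigma-algebra. The whole space is
    itself a box of finite measure, so a constant sequence exhausts it. *)
Lemma eq_tuple_measure_box (R : realType) n
    (m1 m2 : {measure set (n.-tuple (measurableTypeR R)) -> \bar R}) :
  (forall B : 'I_n -> set (measurableTypeR R), (forall i, measurable (B i)) ->
    m1 [set y | forall i, B i (tnth y i)] =
    m2 [set y | forall i, B i (tnth y i)]) ->
  (m1 setT < +oo)%E ->
  forall A, measurable A -> m1 A = m2 A.
Proof.
move=> m12 m1oo A mA.
pose box (B : 'I_n -> set (measurableTypeR R)) :=
  [set y : n.-tuple (measurableTypeR R) | forall i, B i (tnth y i)].
pose G := [set box B | B in [set B | forall i, measurable (B i)]].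
have boxT : box (fun=> setT) = setT by apply/seteqP; split.
have mbox B : (forall i, measurable (B i)) -> measurable (box B).
  move=> mB; rewrite [X in measurable X](_ : _ =
      \bigcap_(i in [set: 'I_n]) ((@tnth n _) ^~ i @^-1` B i)).
    apply: fin_bigcap_measurable => // i _; rewrite -[X in measurable X]setTI.
    exact: (@measurable_tnth _ (measurableTypeR R)).
  by apply/seteqP; split=> y By i; [move=> _|]; exact: (By i).
apply: (@measure_unique _ R _ G (fun=> setT)) => //.
- apply/seteqP; split; last first.
    apply: smallest_sub; first exact: sigma_algebra_measurable.
    by move=> _ [B mB <-]; exact: mbox.
  apply: smallest_sub; first exact: smallest_sigma_algebra.
  move=> X; rewrite -bigcup_seq => -[i _ [Y mY <-]].
  (* A generating cylinder is a box all of whose sides but one are full. *)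
  apply: sub_sigma_algebra; exists (fun j => if j == i then Y else setT).
    by move=> j; case: ifP.
  rewrite setTI; apply/seteqP; split=> y /=.
    by move=> /(_ i); rewrite eqxx.
  by move=> Yi j; case: eqP => [->|].
- move=> _ _ [B mB <-] [C mC <-]; exists (fun i => B i `&` C i).
    by move=> i; exact: measurableI.
  apply/seteqP; split=> y /= => [BC|[By Cy] i].
    by split=> i; have [] := BC i.
  by split.
- by exists (fun=> setT).
- by rewrite bigcup_const.
- by move=> _ [B mB <-]; exact: m12.
Qed.

(** The law of [U] and the measure with the product density agree on boxes, hence everywhere. On a
    box, independence reduces the claim to one coordinate, where agreement on rays is enough. *)
Lemma independent_joint_density d (T : measurableType d) (R : realType)
    (P : probability T R) n (U : 'I_n -> T -> R) (h : 'I_n -> R -> R) :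
  (forall i, measurable_fun setT (U i)) ->
  (forall i, measurable_fun setT (h i)) -> (forall i x, 0 <= h i x) ->
  (forall i x, P (U i @^-1` `]x, +oo[) =
    \int[@lebesgue_measure R]_(y in `]x, +oo[) (h i y)%:E)%E ->
  (forall B : 'I_n -> set R, (forall i, measurable (B i)) ->
    P [set w | forall i, B i (U i w)] = \prod_i P (U i @^-1` B i))%E ->
  forall S : set (n.-tuple (measurableTypeR R)), measurable S ->
  P [set w | S [tuple U i w | i < n]] =
  (\int[lebesgue_tuple R n]_(y in S) (\prod_i h i (tnth y i))%:E)%E.
Proof.
move=> mU mh h0 Ph PU S mS.
have Poo : (P setT < +oo)%E by rewrite probability_setT ltry.
have Ui i (B : set R) : measurable B ->
    P (U i @^-1` B) = (\int[@lebesgue_measure R]_(y in B) (h i y)%:E)%E.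
  move=> mB.
  have mUi : measurable_fun setT (U i : T -> measurableTypeR R) by exact: mU.
  have [m1 m1E] := ex_pushforward_measure _ _ _ _ _ P _ mUi.
  have mhE : measurable_fun setT (EFin \o h i : measurableTypeR R -> \bar R).
    by apply/measurable_EFinP; exact: mh.
  have [m2 m2E] := @ex_density_measure _ _ R (@lebesgue_measure R) _ mhE (h0 i).
  rewrite -m1E -m2E; apply: eq_finite_measure_ray mB.
  - by move=> x; rewrite m1E m2E; exact: Ph.
  - by rewrite m1E preimage_setT; exact: Poo.
have mUt : measurable_fun setT
    (fun w => [tuple U i w | i < n] : n.-tuple (measurableTypeR R)).
  apply/measurable_fun_tnthP => i; apply: eq_measurable_fun (mU i) => w _ /=.
  by rewrite tnth_mktuple.
have [m1 m1E] := ex_pushforward_measure _ _ _ _ _ P _ mUt.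
pose hE y := (\prod_i h i (tnth y i))%:E.
have mhE : measurable_fun setT (hE : n.-tuple (measurableTypeR R) -> \bar R).
  by apply/measurable_EFinP; exact: measurable_prod_tnth.
have hE0 y : (0 <= hE y)%E by rewrite lee_fin prodr_ge0.
have [m2 m2E] := @ex_density_measure _ _ R (lebesgue_tuple R n) _ mhE hE0.
rewrite -[LHS]m1E -[RHS]m2E; apply: eq_tuple_measure_box mS; last first.
  by rewrite m1E preimage_setT; exact: Poo.
move=> B mB; rewrite m1E m2E.
transitivity (P [set w | forall i, B i (U i w)]).
  congr (P _); apply/seteqP; split=> w /= H i; have := H i;
    by rewrite tnth_mktuple.
rewrite PU// integral_mkcond.
(* The indicator of a box is a product of one-variable indicators, so the density cut to the box is
   still a product. *)
transitivity (\int[lebesgue_tuple R n]_y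
    (\prod_i (h i (tnth y i) * \1_(B i) (tnth y i)))%:E)%E.
  rewrite (@integral_lebesgue_tuple_prod _ _ (fun i x => h i x * \1_(B i) x)).
  - apply: eq_bigr => i _; rewrite Ui; last exact: mB.
    rewrite [LHS]integral_mkcond; apply: eq_integral => x _.
    by rewrite patchE indicE; case: ifPn => _; rewrite ?mulr1 ?mulr0.
  - move=> i; apply: measurable_funM => //.
    by apply: measurable_indic; exact: mB.
  - by move=> i x; rewrite mulr_ge0.
apply: eq_integral => y _; rewrite patchE; case: ifPn => [/set_mem/= yB|yB].
  by congr EFin; apply: eq_bigr => i _; rewrite indicE mem_set// mulr1.
have /existsNP[i Bi] : ~ forall i, B i (tnth y i).
  by move=> H; rewrite mem_set in yB.
by rewrite (bigD1 i)//= indicE memNset// mulr0 mul0r.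
Qed.

(** * Distribution functions and the law of [F \o X] *)

(** By monotonicity a value above 1 would persist up to [+oo], against the limit 1. *)
Lemma cumulative_le1 (R : realType) (F : cumulativeBounded (0 : R) (1 : R)) x :
  F x <= 1.
Proof.
rewrite leNgt; apply/negP => F1.
have := cvgr_lt _ (cumulativey F) _ F1 => nF.
near (+oo%R : set_system R) => y.
have : F x <= F y.
  apply: (cumulative_is_nondecreasing F).
  by near: y; apply: nbhs_pinfty_ge; exact: num_real.
by apply/negP; rewrite -ltNge; near: y; exact: nF.
Unshelve. all: by end_near. Qed.

Lemma cumulative_ge0 (R : realType) (F : cumulativeBounded (0 : R) (1 : R)) x :
  0 <= F x.
Proof.
rewrite leNgt; apply/negP => F1.
have := cvgr_gt _ (cumulativeNy F) _ F1 => nF.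
near (-oo%R : set_system R) => y.
have : F y <= F x.
  apply: (cumulative_is_nondecreasing F).
  by near: y; apply: nbhs_ninfty_le; exact: num_real.
by apply/negP; rewrite -ltNge; near: y; exact: nF.
Unshelve. all: by end_near. Qed.

(** A substitute for the inverse of [F], which may have flat pieces: [s] is the supremum of the
    closed sublevel set of [u]. At [u = 0] that set could be empty, hence the extra condition
    there. *)
Lemma cumulative_level (R : realType)
    (F : cumulativeBounded (0 : R) (1 : R)) u :
  continuous F -> 0 < u < 1 \/ u = 0 /\ (exists x, F x <= 0) ->
  exists s, F s = u /\ forall x, (F x <= u) = (x <= s).
Proof.
move=> cF u01.
pose S := [set x | F x <= u].
have S0 : S !=set0.
  case: u01 => [/andP[u0 _]|[u0 [x Fx]]]; last by exists x; rewrite /S/= u0.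
  have := cvgr_lt _ (cumulativeNy F) _ u0 => nF.
  by near (-oo%R : set_system R) => y; exists y; apply: ltW; near: y; exact: nF.
have u1 : u < 1 by case: u01 => [/andP[]//|[-> _]].
have Sub : has_ubound S.
  have := cvgr_gt _ (cumulativey F) _ u1 => nF.
  near (+oo%R : set_system R) => y; exists y => x Sx.
  rewrite leNgt; apply/negP => /ltW yx.
  have : F y <= u by apply: le_trans Sx; exact: (cumulative_is_nondecreasing F).
  by apply/negP; rewrite -ltNge; near: y; exact: nF.
have cS : closed S.
  apply: (@closed_comp _ _ F [set y | y <= u]) => [x _|]; first exact: cF.
  exact: closed_le.
have Ss : F (sup S) <= u by rewrite -/(S _); apply: cS; exact: closure_sup.
have gtS x : sup S < x -> u < F x.
  move=> sx; rewrite ltNge; apply/negP => Sx.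
  by move: sx; rewrite ltNge ub_le_sup.
exists (sup S); split; last first.
  move=> x; apply/idP/idP => [Sx|xs]; first exact: ub_le_sup.
  by apply: le_trans Ss; exact: (cumulative_is_nondecreasing F).
(* If [F (sup S) < u], continuity keeps [F] below [u] just to the right of [sup S], where [F]
   exceeds [u]. *)
apply/eqP; rewrite eq_le Ss leNgt; apply/negP => Fsu.
have nF := cvgr_lt _ (cvg_at_right_filter (cF (sup S))) _ Fsu.
near (sup S)^'+ => x.
have : u < F x by apply: gtS; near: x; exact: nbhs_right_gt.
by apply/negP; rewrite -leNgt ltW//; near: x; exact: nF.
Unshelve. all: by end_near. Qed.

(** In the main case [F \o X <= u] is the event [X <= s] with [F s = u], of probability
    [G (F s) = G u]. The remaining cases are those where the event is sure or impossible. *)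
Lemma probability_comp_cdf_ray d (T : measurableType d) (R : realType)
    (P : probability T R) (X : {RV P >-> R})
    (F : cumulativeBounded (0 : R) (1 : R)) (G : R -> R) u :
  continuous F -> G 0 = 0 -> G 1 = 1 ->
  (forall x, cdf X x = (G (F x))%:E) ->
  P ((F \o X) @^-1` `]u, +oo[) = (G 1 - G (Num.min 1 (Num.max 0 u)))%:E.
Proof.
move=> cF G0 G1 XG.
have PT c : c = 0 -> (forall x, u < F x) ->
    P ((F \o X) @^-1` `]u, +oo[) = (G 1 - G c)%:E.
  move=> -> uF; rewrite G0 G1 subr0 -(@probability_setT _ T R P); congr (P _).
  by apply/seteqP; split => // w _ /=; rewrite in_itv/= uF.
have [u0|u0] := ltP u 0.
  apply: PT; first by rewrite min_r.
  by move=> x; exact: lt_le_trans (cumulative_ge0 _ F x).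
have [u1|u1] := leP 1 u.
  rewrite subrr -[RHS](@measure0 _ _ _ P); congr (P _).
  apply/seteqP; split => // w /=; rewrite in_itv/= andbT ltNge.
  by rewrite (le_trans (cumulative_le1 _ F (X w))).
have [uF|/existsNP[x /negP]] := pselect (forall x, u < F x).
  (* Every level in []0, 1[] is attained, so [F > u] everywhere with [0 <= u < 1] forces [u = 0]. *)
  apply: PT => //; apply/eqP; rewrite eq_le u0 andbT leNgt; apply/negP => u0'.
  have [|s [Fs _]] := @cumulative_level R F u cF; first by left; rewrite u0'.
  by have := uF s; rewrite Fs ltxx.
rewrite -leNgt => Fxu.
have [|s [Fs FE]] := @cumulative_level R F u cF.
  move: u0; rewrite le_eqVlt => /orP[/eqP u0|u0]; last by left; rewrite u0.
  by right; split => //; exists x; move: Fxu; rewrite -u0.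
transitivity (1 - cdf X s)%E; last by rewrite XG Fs G1 EFinB.
rewrite /cdf /distribution /pushforward -probability_setC; last first.
  exact: measurable_funPTI.
congr (P _); apply/seteqP; split => w /=; rewrite !in_itv/= andbT -FE.
  by rewrite ltNge => /negP.
by move=> /negP; rewrite -ltNge.
Qed.

(** * Combinatorics of ranks and sorted arrangements *)

Section ranks.
Context (k : nat) (n_ : 'I_k -> nat).
Local Notation n := (\sum_i n_ i)%N.
Implicit Types (r : 'S_n) (s t : 'I_n).

(** Reads a dependent family along the numbering of pairs, so that it is indexed by the ordinal type
    on which [r] acts. *)
Definition flat {S : Type} (x : forall i, 'I_(n_ i) -> S) s : S :=
  x (tag (tagnat.sig s)) (tagged (tagnat.sig s)).

Lemma flat_sig12 S (x : forall i, 'I_(n_ i) -> S) s :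
  flat x s = x (tagnat.sig1 s) (tagnat.sig2 s).
Proof. by rewrite /flat tagnat.sigE12. Qed.

Lemma flat_rank S (x : forall i, 'I_(n_ i) -> S) (p : {i : 'I_k & 'I_(n_ i)}) :
  flat x (tagnat.rank p) = x (tag p) (tagged p).
Proof. by rewrite /flat tagnat.rankK. Qed.

Lemma flat_entry S (y : n.-tuple S) s : flat (entry y) s = tnth y s.
Proof. by rewrite flat_sig12 /entry tagnat.sig2K. Qed.

Lemma prod_flat (R : comNzRingType) (x : forall i, 'I_(n_ i) -> R) :
  \prod_i \prod_(j < n_ i) x i j = \prod_s flat x s.
Proof.
rewrite (sig_big_dep (fun=> true) (fun i => fun=> true) x)/=.
rewrite (reindex tagnat.sig)/=; last exact: tagnat.sig_bij_on.
by apply: eq_bigl.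
Qed.

Lemma sorted_arrangedP (R : realType) r (x : forall i, 'I_(n_ i) -> R) :
  reflect (forall s t, (r s <= r t)%N -> flat x s <= flat x t)
    (sorted <=%R (arranged r x)).
Proof.
have nthE (l : 'I_n) : nth 0 (arranged r x) l = flat x (r^-1%g l).
  by rewrite (nth_map l) ?size_enum_ord// nth_ord_enum flat_sig12.
have sz : size (arranged r x) = n by rewrite size_map size_enum_ord.
apply: (iffP idP) => [srt s t rst|xr].
  have := sorted_leq_nth le_trans lexx 0 srt (r s) (r t).
  by rewrite !inE sz !nthE !permK; apply.
apply/(sortedP 0) => i; rewrite sz => i1n.
have in' := ltnW i1n.
rewrite (nthE (Ordinal i1n)) (nthE (Ordinal in')).
by apply: xr; rewrite !permKV/=.
Qed.

(** The clause [a <= b] is explicit because an empty arrangement still leaves the comparison of [a]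
    with [b]. *)
Lemma path_arrangedP (R : realType) r (x : forall i, 'I_(n_ i) -> R) a b :
  reflect
    ((forall s t, (r s <= r t)%N -> flat x s <= flat x t) /\
     (forall s, a <= flat x s <= b) /\ a <= b)
    (path <=%R a (rcons (arranged r x) b)).
Proof.
have mem s : flat x s \in arranged r x.
  apply/mapP; exists (r s); rewrite ?mem_enum//.
  by rewrite flat_sig12 /sample_at /within_at permK.
rewrite path_sortedE; last exact: le_trans.
rewrite (sorted_pairwise le_trans) pairwise_rcons -(sorted_pairwise le_trans).
rewrite all_rcons.
apply: (iffP idP).
  move=> /andP[/andP[ab /allP ax] /andP[/allP xb /sorted_arrangedP xr]].
  by split=> //; split=> // s; rewrite ax//= xb.
move=> [/sorted_arrangedP -> [xab ->]]; rewrite !andbT/=.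
by apply/andP; split; apply/allP => _ /mapP[l _ ->];
  have /andP[] := xab (r^-1%g l);
  rewrite flat_sig12.
Qed.

Lemma rank_vectorE (R : realType) (x : forall i, 'I_(n_ i) -> R)
    i (h : 'I_(n_ i)) :
  rank_vector x i h = #|[pred t | flat x t < flat x (tagnat.Rank i h)]|.+1.
Proof.
rewrite /rank_vector; congr S.
rewrite -(fintype.card_image (@tagnat.rank_inj _ n_)); apply: eq_card => t.
rewrite [RHS]inE -(tagnat.rankE (Tagged (fun i => 'I_(n_ i)) h)) flat_rank/=.
rewrite -[in LHS](tagnat.sigK t) fintype.mem_image; last exact: tagnat.rank_inj.
rewrite [LHS]asboolb -[x _ (tagged (tagnat.sig t))]/(flat x t).
(* A coordinate is never below itself, so the condition [q != (i, h)] is absorbed. *)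
apply/andb_idl => xth.
by apply: contraTneq xth => th; rewrite /flat th/= ltxx.
Qed.

(** [r] maps these indices bijectively onto the ordinals below [r s]. *)
Lemma card_perm_lt r s : #|[pred t | (r t < r s)%N]| = r s.
Proof.
rewrite -[RHS](card_ord (r s)) -(fintype.card_image (@perm_inj _ r)).
have rsn := ltnW (ltn_ord (r s)).
rewrite -(fintype.card_image (f := widen_ord rsn)); last first.
  by move=> u v /(congr1 val)/= /val_inj.
apply: eq_card => l; apply/fintype.imageP/fintype.imageP => [[t + ->]|[u _ ->]].
  by rewrite inE => rts; exists (Ordinal rts) => //; exact: val_inj.
exists (r^-1%g (widen_ord rsn u)); last by rewrite permKV.
by rewrite inE permKV/=.
Qed.

(* Tied coordinates have equal ranks, so a permutation of ranks forces the
   coordinates to be distinct. *)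
Lemma rank_vector_permP (R : realType) r (x : forall i, 'I_(n_ i) -> R) :
  (forall i (h : 'I_(n_ i)), rank_vector x i h = (rank_at r i h).+1) <->
  (forall s t, (r s <= r t)%N -> flat x s <= flat x t) /\ injective (flat x).
Proof.
split=> [xr|[xr xinj] i h].
  have rE s : #|[pred t | flat x t < flat x s]| = r s.
    have := xr (tagnat.sig1 s) (tagnat.sig2 s).
    by rewrite rank_vectorE /rank_at tagnat.sig2K => -[].
  split=> [s t|s t xst]; last first.
    by apply/(@perm_inj _ r)/val_inj; rewrite /= -!rE xst.
  rewrite leqNgt => rst; rewrite leNgt; apply: contra rst => xts.
  (* If [x_t < x_s], everything below [x_t] is below [x_s], and [t] itself makes the inclusion
     strict. *)
  rewrite -!rE; apply: proper_card; apply/properP; split.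
    by apply/fintype.subsetP => u; rewrite !inE => /lt_trans; exact.
  by exists t; rewrite !inE ?ltxx.
rewrite rank_vectorE /rank_at -(card_perm_lt r); congr S; apply: eq_card => t.
rewrite !inE; set s := tagnat.Rank i h.
apply/idP/idP => [|rts].
  by rewrite !(ltNge, ltnNge); apply: contra => /xr.
rewrite lt_neqAle xr ?(ltnW rts)// andbT (inj_eq xinj).
by apply: contraTneq rts => ->; rewrite ltnn.
Qed.

End ranks.
Arguments flat {k n_ S} x s.

(** * Measurability of the events and almost sure equality *)

Lemma measurable_le_fun d (T : measurableType d) (R : realType) (f g : T -> R) :
  measurable_fun setT f -> measurable_fun setT g ->
  measurable [set w | f w <= g w].
Proof.
move=> mf mg; rewrite [X in measurable X](_ : _ = (g \- f) @^-1` `[0, +oo[).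
  by rewrite -[X in measurable X]setTI; exact: (measurable_funB mg mf).
by apply/seteqP; split=> w /=; rewrite in_itv/= andbT subr_ge0.
Qed.

Lemma measurable_perm_sorted d (T : measurableType d) (R : realType) n
    (r : 'S_n) (f : 'I_n -> T -> R) : (forall s, measurable_fun setT (f s)) ->
  measurable [set w | forall s t, (r s <= r t)%N -> f s w <= f t w].
Proof.
move=> mf; rewrite [X in measurable X](_ : _ =
  \bigcap_(p in [set p : 'I_n * 'I_n | (r p.1 <= r p.2)%N])
    [set w | f p.1 w <= f p.2 w]).
  by apply: fin_bigcap_measurable => // p _; exact: measurable_le_fun.
by apply/seteqP; split=> w /= H; [move=> [s t]; exact: H|
  move=> s t; exact: H (s, t)].
Qed.

Lemma measurable_injective d (T : measurableType d) (R : realType) n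
    (f : 'I_n -> T -> R) : (forall s, measurable_fun setT (f s)) ->
  measurable [set w | injective (f ^~ w)].
Proof.
move=> mf; rewrite [X in measurable X](_ : _ =
  \bigcap_(p in [set p : 'I_n * 'I_n | p.1 != p.2])
    ~` [set w | f p.1 w = f p.2 w]).
  apply: fin_bigcap_measurable => // p _; apply: measurableC.
  exact: measurable_eq_fun.
apply/seteqP; split=> w /= H.
  by move=> [s t] /= st /H/eqP; exact/negP.
by move=> s t fst; apply/eqP/negPn/negP => /(H (s, t)); apply.
Qed.

(** The difference of [B] and [A] is null, so subadditivity gives the inequality that monotonicity
    does not. *)
Lemma eq_measure_ae d (T : measurableType d) (R : realType)
    (mu : {measure set T -> \bar R}) (A B : set T) :
  measurable A -> measurable B -> A `<=` B ->
  {ae mu, forall w, B w -> A w} -> mu A = mu B.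
Proof.
move=> mA mB AB BA; apply/eqP; rewrite eq_le le_measure ?inE//=.
have mBA : measurable (B `\` A) by exact: measurableD.
have /(negligibleP _ mBA) BA0 : mu.-negligible (B `\` A).
  by apply: negligibleS BA => w [Bw Aw] /(_ Bw).
rewrite -[leRHS]adde0 -BA0 (le_trans _ (measureU2 _ _ _))//.
rewrite le_measure ?inE//; first exact: measurableU.
by move=> w Bw; have [|] := pselect (A w); [left|right].
Qed.

Lemma measurable_path_arranged (R : realType) (k : nat) (n_ : 'I_k -> nat)
    (r : 'S_(\sum_i n_ i)) :
  measurable [set y : (\sum_i n_ i).-tuple (measurableTypeR R) |
    path <=%R (0 : R) (rcons (arranged r (entry y)) 1)].
Proof.
set n := (\sum_i n_ i)%N.
have mt s : measurable_fun setT
    (fun y : n.-tuple (measurableTypeR R) => tnth y s : R).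
  exact: (@measurable_tnth _ (measurableTypeR R)).
rewrite [X in measurable X](_ : _ =
  [set y : n.-tuple (measurableTypeR R) |
    forall s t, (r s <= r t)%N -> (tnth y s : R) <= tnth y t] `&`
  \bigcap_(s in [set: 'I_n])
    ((fun y : n.-tuple (measurableTypeR R) => tnth y s) @^-1` `[0%R, 1%R])).
  apply: measurableI.
    exact: (@measurable_perm_sorted _ _ R _ r
      (fun s (y : n.-tuple (measurableTypeR R)) => tnth y s)).
  apply: fin_bigcap_measurable => // s _; rewrite -[X in measurable X]setTI.
  exact: mt.
apply/seteqP; split=> y /=.
  move=> /path_arrangedP [H1 [H2 _]]; split.
    by move=> s t; rewrite -!flat_entry; exact: H1.
  by move=> s _; rewrite /= in_itv/= -flat_entry.
move=> [H1 H2]; apply/path_arrangedP; split.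
  by move=> s t; rewrite !flat_entry; exact: H1.
split=> [s|]; last exact: ler01.
by rewrite flat_entry; have := H2 s I; rewrite /= in_itv.
Qed.

Theorem theorem1 (R : realType) (k : nat) (k_ge2 : (2 <= k)%N)
    (n_ : 'I_k -> nat) (n_ge1 : forall i, (1 <= n_ i)%N)
    (F : cumulativeBounded (0 : R) (1 : R)) (F_continuous : continuous F)
    (d : measure_display) (T : measurableType d) (P : probability T R)
    (X : forall i : 'I_k, 'I_(n_ i) -> {RV P >-> R})
    (X_indep : mutually_independent
      (fun p : {i : 'I_k & 'I_(n_ i)} => X (tag p) (tagged p)))
    (X_cdf : forall (i : 'I_k) (j : 'I_(n_ i)) (x : R),
      cdf (X i j) x = (upper_binomial_df k i.+1 F x)%:E)
    (r : 'S_(\sum_i n_ i)) :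
  P [set w | forall (i : 'I_k) (j : 'I_(n_ i)),
       rank_vector (fun i j => X i j w) i j = (rank_at r i j).+1] =
    P [set w | sorted <=%R (arranged r (fun i j => X i j w))] /\
  P [set w | sorted <=%R (arranged r (fun i j => X i j w))] =
    (\int[lebesgue_tuple R (\sum_i n_ i)]_(y in
        [set y : (\sum_i n_ i).-tuple R |
          path <=%R 0%R (rcons (arranged r (entry y)) 1%R)])
      (\prod_(i < k) \prod_(j < n_ i)
        ((upper_binomial_poly R k i.+1)^`()).[entry y i j])%R%:E)%E.
Proof.

pose G (s : 'I_(\sum_i n_ i)) : {poly R} :=
  upper_binomial_poly R k (tag (tagnat.sig s)).+1.
(* The cut to [[0, 1]] matters: outside this interval the derivative can be negative. *)
pose h (s : 'I_(\sum_i n_ i)) x : R := ((G s)^`()).[x] * \1_`[0, 1] x.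
pose U (s : 'I_(\sum_i n_ i)) w : R := F (flat (fun i j => X i j w) s).
have mF : measurable_fun setT F by exact: continuous_measurable_fun.
have mX s : measurable_fun setT (fun w => flat (fun i j => X i j w) s).
  exact: measurable_funP.
have mU s : measurable_fun setT (U s) by exact: measurableT_comp mF (mX s).
have mh s : measurable_fun setT (h s).
  apply: measurable_funM; last exact: measurable_indic.
  by apply: continuous_measurable_fun => x; exact: continuous_horner.
have h0 s x : 0 <= h s x.
  rewrite /h indicE; have [/set_mem/= x01|_] := boolP (x \in _); last first.
    by rewrite mulr0.
  by rewrite mulr1 deriv_upper_binomial_poly_ge0// -in_itv.
(* Both sides equal [G_s(1) - G_s(c)], where [c] is [x] clamped to [[0, 1]]. *)
have PhU s x : P (U s @^-1` `]x, +oo[) =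
    (\int[@lebesgue_measure R]_(y in `]x, +oo[) (h s y)%:E)%E.
  rewrite integral_deriv_ray.
  apply: (@probability_comp_cdf_ray _ _ _ P
    (X _ (tagged (tagnat.sig s))) F (horner (G s))) => //.
  - exact: upper_binomial_poly0.
  - exact: upper_binomial_poly1.
  - by move=> z; rewrite X_cdf horner_upper_binomial_poly.
have PU (B : 'I_(\sum_i n_ i) -> set R) : (forall i, measurable (B i)) ->
    (P [set w | forall i, B i (U i w)] = \prod_i P (U i @^-1` B i))%E.
  (* [U_s] lies in [B s] exactly when the corresponding [X] lies in the preimage of [B s] under [F];
     independence is applied to the full index set. *)
  move=> mB; pose C (p : {i : 'I_k & 'I_(n_ i)}) := F @^-1` B (tagnat.rank p).
  have := X_indep [set: {i : 'I_k & 'I_(n_ i)}]%SET C.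
  have mC p : measurable (C p).
    by rewrite -[C p]setTI; exact: mF.
  move=> /(_ (fun p _ => mC p)) XI.
  transitivity (\prod_p P (X (tag p) (tagged p) @^-1` C p))%E.
    transitivity (\prod_(p in [set: {i : 'I_k & 'I_(n_ i)}]%SET)
        P (X (tag p) (tagged p) @^-1` C p))%E; last first.
      by apply: eq_bigl => p; rewrite finset.in_setT.
    rewrite -XI; congr (P _); apply/seteqP; split=> w /= H.
      move=> p _; have := H (tagnat.rank p).
      by rewrite /U (flat_rank _ _ _ (fun i j => X i j w)).
    move=> s; have := H (tagnat.sig s).
    by rewrite /C/= tagnat.sigK; apply; rewrite /= finset.in_setT.
  rewrite (reindex tagnat.sig)/=; last exact: tagnat.sig_bij_on.
  by apply: eq_bigr => s _; rewrite /C tagnat.sigK.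
have joint S mS :=
  @independent_joint_density _ _ _ P _ U h mU mh h0 PhU PU S mS.
pose S := [set y : (\sum_i n_ i).-tuple (measurableTypeR R) |
  path <=%R (0 : R) (rcons (arranged r (entry y)) 1)].
have mS : measurable S by exact: measurable_path_arranged.
have mprod : measurable_fun setT
    (fun y : (\sum_i n_ i).-tuple (measurableTypeR R) =>
      (\prod_s h s (tnth y s))%:E).
  by apply/measurable_EFinP; exact: measurable_prod_tnth.
have no_ties : {ae P, forall w, injective (U ^~ w)}.
  have : {ae P, forall w (p : 'I_(\sum_i n_ i) * 'I_(\sum_i n_ i)),
      p.1 != p.2 -> U p.1 w <> U p.2 w}.
    apply: filter_forall => -[s t] /=.
    have [->|st] := eqVneq s t; first exact: nearW.
    (* The probability of a tie is the integral of the joint density over a null diagonal. *)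
    have mD := @measurable_diagonal R _ s t.
    exists (fun w => U s w = U t w); split.
    - exact: measurable_eq_fun.
    - have := joint _ mD; rewrite null_set_integral//; last first.
      + exact: lebesgue_tuple_diagonal.
      + exact: measurable_funTS.
      by under eq_set do rewrite /= !tnth_mktuple.
    - by move=> w /= /not_implyP[_ /contrapT].
  apply: filterS => w Uw s t; apply: contra_eq => st; apply/eqP.
  exact: (Uw (s, t)).
(* [E1] is the event of rank vector [r]; [E2] and [E3] say that [X], respectively [U], is sorted
   along [r]. The inclusions from [E1] to [E2] to [E3] always hold, and almost surely [E3] implies
   [E1]. *)
pose E1 := [set w | (forall s t, (r s <= r t)%N ->
  flat (fun i j => X i j w) s <= flat (fun i j => X i j w) t) /\
  injective (flat (fun i j => X i j w))].
pose E2 := [set w | forall s t, (r s <= r t)%N ->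
  flat (fun i j => X i j w) s <= flat (fun i j => X i j w) t].
pose E3 := [set w | forall s t, (r s <= r t)%N -> U s w <= U t w].
have mE1 : measurable E1.
  apply: measurableI; first exact: measurable_perm_sorted.
  exact: measurable_injective.
have mE2 : measurable E2 by exact: measurable_perm_sorted.
have mE3 : measurable E3 by exact: measurable_perm_sorted.
have E12 : E1 `<=` E2 by move=> w [].
have E23 : E2 `<=` E3.
  by move=> w H s t /H; exact: (cumulative_is_nondecreasing F).
have E31 : {ae P, forall w, E3 w -> E1 w}.
  apply: filterS no_ties => w Uinj H; split=> [s t rst|s t st]; last first.
    by apply: Uinj; rewrite /U st.
  (* A pair of [X] in the wrong order has [U] values ordered both ways, hence a tie of [U]. *)
  rewrite leNgt; apply/negP => ts.
  have : U s w = U t w.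
    apply/eqP; rewrite eq_le H//=.
    by apply: (cumulative_is_nondecreasing F); exact: ltW.
  by move=> /Uinj st; rewrite st ltxx in ts.
have PE12 : P E1 = P E2.
  by apply: eq_measure_ae => //; apply: filterS E31 => w + /E23.
have PE23 : P E2 = P E3.
  by apply: eq_measure_ae => //; apply: filterS E31 => w E31w /E31w /E12.
have -> : [set w | forall (i : 'I_k) (j : 'I_(n_ i)),
    rank_vector (fun i j => X i j w) i j = (rank_at r i j).+1] = E1.
  by apply/seteqP; split=> w /rank_vector_permP.
have -> : [set w | sorted <=%R (arranged r (fun i j => X i j w))] = E2.
  by apply/seteqP; split=> w /sorted_arrangedP.
split=> //; rewrite PE23.
(* The bounds 0 and 1 of the path hold automatically, since [F] takes its values in [[0, 1]]. *)
transitivity (P [set w | S [tuple U s w | s < _]]).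
  congr (P _); apply/seteqP; split=> w /=.
    move=> H; apply/path_arrangedP; split.
      by move=> s t; rewrite !flat_entry !tnth_mktuple; exact: H.
    split=> [s|]; last exact: ler01.
    by rewrite flat_entry tnth_mktuple cumulative_ge0 cumulative_le1.
  move=> /path_arrangedP[H _] s t /H.
  by rewrite !flat_entry !tnth_mktuple.
(* On [S] all coordinates are in [[0, 1]], so the indicators in [h] equal 1. *)
rewrite joint//; apply: eq_integral => y /set_mem /path_arrangedP[_ [y01 _]].
congr EFin.
rewrite (prod_flat _ _ _
  (fun i j => ((upper_binomial_poly R k i.+1)^`()).[entry y i j])).
apply: eq_bigr => s _; rewrite /h indicE mem_set ?mulr1; last first.
  by rewrite /= in_itv/= -flat_entry.
by rewrite -flat_entry.
Qed.
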